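(* Let $\kappa, s_1, s_2 \in \mathbb{R}$ and let $K(x,y)$ be a measurable kernel on $\mathbb{R}\times\mathbb{R}$ satisfying $|K(x,y)| \sim (1+|x|+|y|)^{-\kappa}$. Suppose $s_1<0$ and $\kappa>\max\{1/2-s_1,\ 1+s_2-s_1\}$. Then the integral operator $(Kf)(x)=\int_{-\infty}^{+\infty}K(x,y)f(y)\,dy$ is a bounded linear operator $K: H^{s_1}(\mathbb{R})\rightarrow H^{s_2}(\mathbb{R})$.
   Context: For $s\in\mathbb{R}$, $H^s(\mathbb{R})$ denotes here the weighted space of (classes of a.e. equal) measurable functions $f:\mathbb{R}\to\mathbb{C}$ with finite norm $\|f\|_s=\left(\int_{\mathbb{R}}|f(x)|^2(1+|x|)^{2s}\,dx\right)^{1/2}$ (the weight acts on $f$ itself, no Fourier transform is taken in this norm). The relation $|K(x,y)|\sim(1+|x|+|y|)^{-\kappa}$ means that there are constants $c_1,c_2>0$ with $c_1(1+|x|+|y|)^{-\kappa}\le|K(x,y)|\le c_2(1+|x|+|y|)^{-\kappa}$ for all $x,y\in\mathbb{R}$. *)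

(* Defs.v *)
From HB Require Import structures.
From mathcomp Require Import all_boot all_order all_algebra.
From mathcomp Require Import generic_quotient ring_quotient.
From mathcomp Require Import all_classical all_reals all_analysis.
From mathcomp Require Import measurable_realfun complex.
Import numFieldNormedType.Exports.
Set Implicit Arguments.
Unset Strict Implicit.
Unset Printing Implicit Defensive.
Import Order.TTheory GRing.Theory Num.Theory.
Import ComplexField.Normc.
Local Open Scope classical_set_scope.
Local Open Scope ring_scope.
Local Open Scope quotient_scope.

(* Complex-valued functions are handled componentwise: the Borel sigma-algebra
   of C = R^2 is the product one, and the integral is taken on the real and
   the imaginary part. *)
Section complex_integration.
Context d (T : measurableType d) (R : realType).
Implicit Type f : T -> R[i].

Definition cmeasurable f :=
  measurable_fun [set: T] (fun x => complex.Re (f x)) /\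
  measurable_fun [set: T] (fun x => complex.Im (f x)).

Variable mu : {measure set T -> \bar R}.

Definition cintegrable f :=
  mu.-integrable [set: T] (fun x => (complex.Re (f x))%:E) /\
  mu.-integrable [set: T] (fun x => (complex.Im (f x))%:E).

Definition cintegral f : R[i] :=
  Complex (\int[mu]_x complex.Re (f x)) (\int[mu]_x complex.Im (f x)).

End complex_integration.

Lemma normc_ge0 (R : rcfType) (z : R[i]) : 0 <= normc z.
Proof. by case: z => ? ?; exact: sqrtr_ge0. Qed.

Section weighted_norm.
Context d (T : measurableType d) (R : realType).
Variables (mu : {measure set T -> \bar R}) (w : T -> R).
Implicit Types (f g : T -> R[i]) (a : R[i]).

Definition wnorme f : \bar R :=
  ((\int[mu]_x (normc (f x) ^+ 2 * w x)%:E) `^ 2^-1)%E.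

Lemma cmeasurable0 : cmeasurable (0 : T -> R[i]).
Proof. by split; exact: measurable_cst. Qed.

Lemma cmeasurableD f g : cmeasurable f -> cmeasurable g -> cmeasurable (f + g).
Proof.
have ReD (z t : R[i]) : complex.Re (z + t) = complex.Re z + complex.Re t.
  by case: z t => ? ? [].
have ImD (z t : R[i]) : complex.Im (z + t) = complex.Im z + complex.Im t.
  by case: z t => ? ? [].
move=> [f1 f2] [g1 g2]; split.
- by under eq_fun do rewrite ReD; exact: measurable_funD.
- by under eq_fun do rewrite ImD; exact: measurable_funD.
Qed.

Lemma cmeasurableZ a f : cmeasurable f -> cmeasurable (a *: f).
Proof.
have ReM (z t : R[i]) : complex.Re (z * t) =
    complex.Re z * complex.Re t - complex.Im z * complex.Im t.
  by case: z t => ? ? [].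
have ImM (z t : R[i]) : complex.Im (z * t) =
    complex.Re z * complex.Im t + complex.Im z * complex.Re t.
  by case: z t => ? ? [].
move=> [f1 f2]; split.
- under eq_fun do rewrite ReM.
  by apply: measurable_funB; apply: measurable_funM.
- under eq_fun do rewrite ImM.
  by apply: measurable_funD; apply: measurable_funM.
Qed.

Lemma measurable_normc f : cmeasurable f ->
  measurable_fun [set: T] (fun x => normc (f x)).
Proof.
have nE (z : R[i]) : normc z = Num.sqrt (complex.Re z ^+ 2 + complex.Im z ^+ 2).
  by case: z.
move=> [mRe mIm]; under eq_fun do rewrite nE.
apply: (@measurableT_comp _ _ _ _ _ _ (@Num.sqrt R)).
  exact: (continuous_measurable_fun (@sqrt_continuous R)).
by apply: measurable_funD; apply: measurable_funX.
Qed.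

Hypotheses (mw : measurable_fun [set: T] w) (w_gt0 : forall x, 0 < w x).

Let wt f (x : T) : R := normc (f x) * Num.sqrt (w x).

Let wt_ge0 f x : 0 <= wt f x.
Proof. by rewrite mulr_ge0 ?normc_ge0 ?sqrtr_ge0. Qed.

Let integrand_ge0 f x : (0 <= (normc (f x) ^+ 2 * w x)%:E)%E.
Proof. by rewrite lee_fin mulr_ge0 ?sqr_ge0// ltW. Qed.

Let wnormeE f : wnorme f = 'N[mu]_2%:E[EFin \o wt f]%E.
Proof.
rewrite unlock /wnorme /Lnorm/=; congr (_ `^ _)%E; apply: eq_integral => x _ /=.
rewrite (ger0_norm (wt_ge0 f x)) (powR_mulrn 2 (wt_ge0 f x)) exprMn.
by rewrite sqr_sqrtr// ltW.
Qed.

Let measurable_wt f : cmeasurable f -> measurable_fun [set: T] (wt f).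
Proof.
move=> mf; apply: measurable_funM; first exact: measurable_normc.
apply: (@measurableT_comp _ _ _ _ _ _ (@Num.sqrt R)) => //.
exact: (continuous_measurable_fun (@sqrt_continuous R)).
Qed.

Let measurable_integrand f : cmeasurable f ->
  measurable_fun [set: T] (fun x => (normc (f x) ^+ 2 * w x)%:E).
Proof.
move=> mf; apply/measurable_EFinP; apply: measurable_funM => //.
exact/measurable_funX/measurable_normc.
Qed.

Lemma wnormeD f g : cmeasurable f -> cmeasurable g ->
  (wnorme (f + g)%R <= wnorme f + wnorme g)%E.
Proof.
move=> mf mg; rewrite !wnormeE.
apply: (@le_trans _ _ 'N[mu]_2%:E[EFin \o (wt f \+ wt g)%R]%E); last first.
  by apply: minkowski_EFin; rewrite ?ler1n//; exact: measurable_wt.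
rewrite unlock /Lnorm; apply: gt0_ler_poweR.
- by rewrite invr_ge0.
- rewrite in_itv/= leey andbT; apply: integral_ge0 => x _.
  by rewrite lee_fin powR_ge0.
- rewrite in_itv/= leey andbT; apply: integral_ge0 => x _.
  by rewrite lee_fin powR_ge0.
have mp (h : T -> R) : measurable_fun [set: T] h ->
    measurable_fun [set: T] (fun x => (`|(EFin \o h) x| `^ 2)%E).
  move=> mh; apply: (@measurableT_comp _ _ _ _ _ _ (fun y => y `^ 2)%E) => //.
    exact: measurable_poweR.
  exact/measurableT_comp/measurable_EFinP.
apply: ge0_le_integral => //.
- by move=> x _; rewrite lee_fin powR_ge0.
- exact/mp/measurable_wt/cmeasurableD.
- by apply: mp; apply: measurable_funD; exact: measurable_wt.
move=> x _ /=; rewrite lee_fin !powR_mulrn// ler_pXn2r// ?nnegrE//.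
rewrite (ger0_norm (wt_ge0 _ _)) ger0_norm ?addr_ge0//.
rewrite /wt -mulrDl ler_wpM2r ?sqrtr_ge0//.
exact: (@le_normcD R (f x) (g x)).
Qed.

Lemma wnormeZ a f : cmeasurable f ->
  wnorme (a *: f) = ((normc a)%:E * wnorme f)%E.
Proof.
move=> mf; rewrite /wnorme.
have nZ x : (normc ((a *: f) x) ^+ 2 * w x)%:E =
    ((normc a ^+ 2)%:E * (normc (f x) ^+ 2 * w x)%:E)%E.
  rewrite (_ : normc ((a *: f) x) = normc a * normc (f x)); last exact: normcM.
  by rewrite exprMn -mulrA EFinM.
under eq_integral do rewrite nZ.
rewrite ge0_integralZl//; last 2 first.
- exact: measurable_integrand.
- by rewrite lee_fin sqr_ge0.
rewrite poweRM; last 2 first.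
- by rewrite lee_fin sqr_ge0.
- exact: integral_ge0.
congr (_ * _)%E; rewrite poweR_EFin; congr EFin.
by rewrite -powR_mulrn ?normc_ge0// -powRrM divff ?powRr1 ?normc_ge0.
Qed.

Lemma wnorme0 : wnorme 0 = 0%E.
Proof.
by rewrite -(scale0r (0 : T -> R[i])) (wnormeZ _ cmeasurable0) normc0 mul0e.
Qed.

Lemma wnorme_ge0 f : (0 <= wnorme f)%E.
Proof. exact: poweR_ge0. Qed.

Lemma wnorme_eq0 f : cmeasurable f -> wnorme f = 0%E -> f = 0 %[ae mu].
Proof.
move=> mf; rewrite wnormeE => h.
have := Lnorm_eq0_eq0 (iffRL (measurable_EFinP _ _) (measurable_wt mf)) _ h.
rewrite lte_fin ltr0n => /(_ isT).
apply: filterS => x /(_ I)/= [] /eqP; rewrite mulf_eq0 sqrtr_eq0.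
by rewrite leNgt w_gt0/= orbF => /eqP/eq0_normc.
Qed.

Lemma ae_eq_wnorme f g : cmeasurable f -> cmeasurable g ->
  f = g %[ae mu] -> wnorme f = wnorme g.
Proof.
move=> mf mg fg; congr (_ `^ _)%E; apply: ge0_ae_eq_integral => //.
- exact: measurable_integrand.
- exact: measurable_integrand.
by apply: filterS fg => x fg xT; rewrite fg.
Qed.

End weighted_norm.

(* The sigma-algebra of line R is that of the Lebesgue measurable subsets of R,
   and not only of the Borel ones; the one of plane R is the two-dimensional
   Lebesgue sigma-algebra, i.e. the completion of the Borel one. *)
Notation lebesgue := (@completed_lebesgue_measure _).

Definition line (R : realType) := caratheodory_type ((wlength (@idfun R))^*)%mu.

Definition plane (R : realType) := g_sigma_algebraType
  (completed_algebra_gen (@lebesgue_measure R \x @lebesgue_measure R)%E).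

Section weighted_space.
Variables (R : realType) (s : R).
Implicit Types (f g : line R -> R[i]) (a : R[i]).

Definition hweight (x : line R) : R := (1 + `|x : R|) `^ (2 * s).

Definition hnorme f : \bar R := wnorme lebesgue hweight f.

Definition hfun_pred : {pred line R -> R[i]} :=
  mem [set f | cmeasurable f /\ (hnorme f < +oo)%E].

Lemma measurable_hweight : measurable_fun [set: line R] hweight.
Proof.
have m1 : measurable_fun [set: R] (fun y : R => (1 + `|y|) `^ (2 * s)).
  apply: (measurableT_comp (measurable_powR (2 * s))).
  by apply: measurable_funD => //; exact: measurable_normr.
move=> _ Y mY; rewrite setTI; apply: sub_caratheodory.
by rewrite -[_ @^-1` _]setTI; exact: m1.
Qed.

Lemma hweight_gt0 x : 0 < hweight x.
Proof. by rewrite powR_gt0// ltr_pwDl. Qed.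

Lemma hfun_submod_closed : submod_closed hfun_pred.
Proof.
have mw := measurable_hweight; have w0 := hweight_gt0.
split.
  rewrite inE/=; split; first exact: cmeasurable0.
  by rewrite /hnorme (wnorme0 _ mw w0).
move=> a f g; rewrite !inE/= => -[mf nf] [mg ng]; split.
  exact/cmeasurableD/mg/cmeasurableZ.
rewrite (le_lt_trans (wnormeD _ mw w0 (cmeasurableZ a mf) mg))//.
rewrite (wnormeZ _ mw w0)// lte_add_pinfty// lte_mul_pinfty//.
by rewrite lee_fin normc_ge0.
Qed.
HB.instance Definition _ :=
  GRing.isSubmodClosed.Build _ _ hfun_pred hfun_submod_closed.

Record hfun := HFun {
  hfun_val :> line R -> R[i] ;
  _ : hfun_val \in hfun_pred }.
HB.instance Definition _ := [isSub for hfun_val].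
HB.instance Definition _ := [Choice of hfun by <:].
HB.instance Definition _ := [SubChoice_isSubLmodule of hfun by <:].

Lemma hfun_measurable (u : hfun) : cmeasurable u.
Proof. by case: u => f /=; rewrite inE => -[]. Qed.

Lemma hfun_finite (u : hfun) : (hnorme u < +oo)%E.
Proof. by case: u => f /=; rewrite inE => -[]. Qed.

Definition hnull : {pred hfun} :=
  mem [set u : hfun | (u : line R -> R[i]) = 0 %[ae lebesgue]].

Lemma hnull_submod_closed : submod_closed hnull.
Proof.
split; first by rewrite inE; exact: aeW.
move=> a u v; rewrite !inE/= => hu hv.
apply: filterS2 hu hv => x hu hv xT.
rewrite -[LHS]/(a * hfun_val u x + hfun_val v x).
by rewrite hu// hv// mulr0 addr0.
Qed.
HB.instance Definition _ :=
  GRing.isSubmodClosed.Build _ _ hnull hnull_submod_closed.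

(* The space H^s itself: a quotient of hfun, see H_eqP and H_norm_pi. *)
Definition Hspace := Quotient.quot hnull.
HB.instance Definition _ := GRing.Zmodule.on Hspace.
HB.instance Definition _ := EqQuotient.on Hspace.

Lemma H_eqP (u v : hfun) : \pi_Hspace u = \pi_Hspace v <->
  (u : line R -> R[i]) = v %[ae lebesgue].
Proof.
split=> [/eqP|uv]; [|apply/eqP]; rewrite -Quotient.idealrBE inE/=.
  by apply: filterS => x uv xT; apply/eqP; rewrite -subr_eq0; exact/eqP/uv.
by apply: filterS uv => x uv xT; apply/eqP; rewrite subr_eq0; exact/eqP/uv.
Qed.

Definition H_scale (a : R[i]) (u : Hspace) : Hspace := \pi_Hspace (a *: repr u).

Lemma H_scaleE a (u : hfun) : H_scale a (\pi_Hspace u) = \pi_Hspace (a *: u).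
Proof.
apply/eqP; rewrite -Quotient.idealrBE -scalerBr rpredZ//.
by rewrite Quotient.idealrBE; apply/eqP; rewrite reprK.
Qed.

Lemma H_scalerA a b u : H_scale a (H_scale b u) = H_scale (a * b) u.
Proof.
by elim/quotW: u => u; rewrite (H_scaleE b u) H_scaleE scalerA H_scaleE.
Qed.

Lemma H_scale1r : left_id 1 H_scale.
Proof. by elim/quotW => u; rewrite H_scaleE scale1r. Qed.

Lemma H_scalerDr : right_distributive H_scale +%R.
Proof.
move=> a; elim/quotW => u; elim/quotW => v.
by rewrite -pi_addr !H_scaleE -pi_addr scalerDr.
Qed.

Lemma H_scalerDl u : {morph H_scale^~ u : a b / a + b}.
Proof.
by elim/quotW: u => u a b; rewrite !H_scaleE scalerDl pi_addr.
Qed.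

HB.instance Definition _ := GRing.Zmodule_isLmodule.Build R[i] Hspace
  H_scalerA H_scale1r H_scalerDr H_scalerDl.

Definition H_norm (u : Hspace) : R := fine (hnorme (repr u)).

Lemma H_norm_fin (u : hfun) : hnorme u \is a fin_num.
Proof. by rewrite ge0_fin_numE ?hfun_finite// wnorme_ge0. Qed.

Lemma H_norm_pi (u : hfun) : H_norm (\pi_Hspace u) = fine (hnorme u).
Proof.
congr fine; apply: ae_eq_wnorme.
- exact: measurable_hweight.
- exact: hweight_gt0.
- exact: hfun_measurable.
- exact: hfun_measurable.
by apply/H_eqP; rewrite reprK.
Qed.

Lemma H_normD u v : H_norm (u + v) <= H_norm u + H_norm v.
Proof.
rewrite -[u]reprK -[v]reprK -raddfD/= !H_norm_pi.
rewrite -fineD ?H_norm_fin// fine_le ?fin_numD ?H_norm_fin//.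
exact: (wnormeD _ measurable_hweight hweight_gt0 (hfun_measurable _)
  (hfun_measurable _)).
Qed.

Lemma H_normZ (a : R[i]) (u : Hspace) : H_norm (a *: u) = normc a * H_norm u.
Proof.
rewrite -[u]reprK [a *: _]H_scaleE !H_norm_pi.
rewrite /hnorme (wnormeZ _ measurable_hweight hweight_gt0 _
  (hfun_measurable (repr u))).
by rewrite fineM ?H_norm_fin.
Qed.

Lemma H_norm_eq0 u : H_norm u = 0 -> u = 0.
Proof.
rewrite -[u]reprK H_norm_pi => u0; rewrite -(raddf0 (\pi_Hspace))/=.
apply/H_eqP/(wnorme_eq0 measurable_hweight hweight_gt0).
  exact: hfun_measurable.
by rewrite -[LHS]fineK ?H_norm_fin// u0.
Qed.

Lemma H_normMn u n : H_norm (u *+ n) = H_norm u *+ n.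
Proof.
rewrite -scaler_nat H_normZ -[in RHS]mulr_natl; congr (_ * _).
rewrite -(rmorph_nat (real_complex R)) /normc/= expr0n addr0 sqrtr_sqr.
by rewrite ger0_norm.
Qed.

Lemma H_normN u : H_norm (- u) = H_norm u.
Proof.
rewrite -scaleN1r H_normZ (_ : normc _ = 1) ?mul1r//.
by rewrite /normc/= oppr0 sqrrN expr1n expr0n addr0 sqrtr1.
Qed.

HB.instance Definition _ :=
  Num.Zmodule_isNormed.Build R Hspace H_normD H_norm_eq0 H_normMn H_normN.

End weighted_space.

Section integral_operator.
Variable R : realType.
Implicit Types (kappa s : R) (K : R -> R -> R[i]).

Definition lebesgue_measurable_kernel K :=
  @cmeasurable _ (plane R) R (fun p => K (p : R * R).1 (p : R * R).2).

Definition kernel_sim kappa K := exists c1 c2 : R,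
  [/\ 0 < c1, 0 < c2 & forall x y,
    c1 * (1 + `|x| + `|y|) `^ (- kappa) <= normc (K x y)
      <= c2 * (1 + `|x| + `|y|) `^ (- kappa)].

(* T maps the class of u to the class of x |-> \int K x y * u y dy, the
   integral being absolutely convergent for almost every x. *)
Definition is_integral_operator K s1 s2 (T : Hspace s1 -> Hspace s2) :=
  forall u : hfun s1, {ae lebesgue, forall x : line R,
    cintegrable lebesgue (fun y : line R => K x y * u y) /\
    repr (T (\pi u)) x = cintegral lebesgue (fun y : line R => K x y * u y)}.

End integral_operator.

(* Main.v *)
(* Since kappa > 1/2 - s1 and kappa > 1 + s2 - s1, one can split kappa = a + b
   with a >= 0, a - s2 > 1/2 and b + s1 > 1/2, and then
   (1 + |x| + |y|)^-kappa <= (1 + |x|)^-a (1 + |y|)^-b.  By Cauchy-Schwarz in y,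
   |Kf(x)| <= C (1 + |x|)^-a ||f||_s1 for every x, and (1 + |x|)^-a is in H^s2.
   For measurability, K is replaced by a kernel that is Borel measurable,
   vanishes on a Borel null set of the plane and equals K elsewhere. *)
Require Import Defs.
From HB Require Import structures.
From mathcomp Require Import all_boot all_order all_algebra.
From mathcomp Require Import generic_quotient ring_quotient.
From mathcomp Require Import all_classical all_reals all_analysis.
From mathcomp Require Import complex.
From mathcomp Require Import measurable_realfun ring lra.
Import Order.TTheory GRing.Theory Num.Theory.
Import numFieldNormedType.Exports.
Local Open Scope classical_set_scope.
Local Open Scope ring_scope.
Import ComplexField.Normc.
Set Implicit Arguments.
Unset Strict Implicit.

(** * Sets and functions measurable for a completed measure *)

(** The sets that become measurable once a measurable null set is removed form a sigma-algebra. It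
    contains the generators, each being the union of a measurable set and a subset of a null set. *)
Lemma completed_measurableD d (T : measurableType d) (R : realType)
    (mu : {measure set T -> \bar R}) (A : set T) :
  (completed_algebra_gen mu).-sigma.-measurable A ->
  exists N, [/\ measurable N, mu N = 0%E & measurable (A `\` N)].
Proof.
pose G := [set B | exists N,
  [/\ measurable N, mu N = 0%E & measurable (B `\` N)]].
suff : (completed_algebra_gen mu).-sigma.-measurable `<=` G by exact.
apply: smallest_sub => [|_ [B mB [M [N [mN N0 MN]] <-]]]; last first.
  exists N; split => //.
  rewrite setDUl (_ : M `\` N = set0) ?setU0; last by rewrite setD_eq0.
  exact: measurableD.
split.
- by exists set0; split; rewrite ?setD0.
- move=> B [N [mN N0 mBN]]; exists N; split => //.
  (* The null set that works for [B] also works for its complement. *)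
  rewrite setTD (_ : _ `\` N = ~` (B `\` N) `\` N).
    by apply: measurableD => //; exact: measurableC.
  apply/seteqP; split=> x /= [h1 h2]; split => //; first by case.
  by move=> Bx; apply: h1.
- move=> F FG; have [N NP] := choice FG.
  have mN : measurable (\bigcup_n N n).
    by apply: bigcupT_measurable => n; have [] := NP n.
  exists (\bigcup_n N n); split => //.
  + apply: measure_negligible => //.
    by apply: negligible_bigcup => n; have [? ? _] := NP n; exact/negligibleP.
  + rewrite (_ : _ `\` _ = \bigcup_n (F n `\` N n) `\` \bigcup_n N n).
      apply: measurableD; last exact: mN.
      by apply: bigcupT_measurable => n; have [] := NP n.
    apply/seteqP; split=> x /= [[n _ Fx] Nx]; split => //; exists n => //.
      by split => // Nnx; apply: Nx; exists n.
    by case: Fx.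
Qed.

Lemma completed_measurable_fun d (T : measurableType d) (R : realType)
    (mu : {measure set T -> \bar R})
    (f : g_sigma_algebraType (completed_algebra_gen mu) -> R) :
  measurable_fun [set: _] f ->
  exists N : set T, [/\ measurable N, mu N = 0%E &
    measurable_fun (~` N) (f : T -> R)].
Proof.
move=> mf.
(* Rays with rational endpoints suffice: only countably many null sets occur. *)
have /choice[N NP] (q : rat) : exists N : set T, [/\ measurable N, mu N = 0%E &
    measurable ((f : T -> R) @^-1` `]ratr q, +oo[ `\` N)].
  by apply: completed_measurableD; rewrite -[_ @^-1` _]setTI; exact: mf.
have mN : measurable (\bigcup_q N q).
  by apply: bigcupT_measurable_rat => q; have [] := NP q.
exists (\bigcup_q N q); split => //.
  apply: measure_negligible => //.
  (* Negligible sets are closed under unions indexed by the naturals, so the rationals are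
     enumerated by [unpickle]; a code of no rational contributes [set0]. *)
  rewrite (_ : \bigcup_q _ = \bigcup_n oapp N set0 (choice.unpickle n)).
    apply: negligible_bigcup => n; case: choice.unpickle => [q|]/=.
      by have [? ? _] := NP q; exact/negligibleP.
    exact: negligible_set0.
  apply/seteqP; split=> y /= [q _ Nq].
    by exists (choice.pickle q); [exact: I|rewrite choice.pickleK; exact: Nq].
  by case: choice.unpickle Nq => [r Nr|//]; exists r.
move=> mD; apply: (measurability _ (RGenOInfty.measurableE R)) =>
  // _ [_ [x ->] <-].
(* The open ray above [x] is the union of the rational rays it contains, and outside all the [N q]
   the preimage of each of these may be replaced by its measurable part. *)
rewrite [X in measurable X](_ : _ =
  ~` (\bigcup_q N q) `&` \bigcup_(q in [set q : rat | x <= ratr q])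
    (f @^-1` `]ratr q, +oo[ `\` N q)).
  apply: measurableI; first exact/measurableC.
  rewrite bigcup_mkcond; apply: bigcupT_measurable_rat => q.
  by case: ifP => // _; have [] := NP q.
apply/seteqP; split=> y /=; rewrite !in_itv/= !andbT => -[Ny].
  move=> /rat_in_itvoo[q]; rewrite in_itv/= => /andP[xq qy].
  split => //; exists q; first exact: ltW.
  by split => [|Nqy]; [rewrite /= in_itv/= andbT|apply: Ny; exists q].
move=> [q /= xq []]; rewrite in_itv/= andbT => qy _; split => //.
exact: le_lt_trans qy.
Qed.

(** * Continuity and integrability of the weight *)

Lemma continuous_weight (R : realType) (p : R) :
  continuous (fun x : R => (1 + `|x|) `^ p).
Proof.
move=> x.
apply: (@continuous_comp _ _ _ (fun x : R => 1 + `|x|) (fun x => x `^ p)).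
  by apply: cvgD; [exact: cvg_cst|exact: norm_continuous].
apply: differentiable_continuous; apply/derivable1_diffP.
by apply: derivable_powR; rewrite in_itv/= andbT ltr_pwDl.
Qed.

(** By evenness this is twice the integral over the half line, where [F] is a primitive; since 1 - p
    < 0, [F] tends to 0 at infinity and the half-line integral is - F 0. *)
Lemma integral_weight_lty (R : realType) (p : R) : 1 < p ->
  (\int[@lebesgue_measure R]_x ((1 + `|x|) `^ (- p))%:E < +oo)%E.
Proof.
move=> p1; rewrite ge0_symfun_integralT; last 3 first.
- by move=> x; exact: powR_ge0.
- exact: continuous_weight.
- by move=> x/=; rewrite normrN.
rewrite lte_mul_pinfty//.
rewrite (_ : [set x | _] = `[0, +oo[%classic); last first.
  by apply/seteqP; split => x/=; rewrite in_itv/= andbT.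
have p1' : 1 - p != 0 by rewrite lt_eqF// subr_lt0.
pose F (x : R) : R := (1 - p)^-1 * (1 + x) `^ (1 - p).
(* The range goes below 0 so that [F] has a two-sided derivative at 0, which gives the continuity at
   the endpoint required by the fundamental theorem. *)
have dF (x : R) : -1 < x -> is_derive x 1 F ((1 + x) `^ (- p)).
  move=> x0; have x1 : 0 < 1 + x by rewrite addrC -ltrBlDr sub0r.
  have h := is_derive1_powR (1 - p) x1.
  have hD : is_derive x 1 (fun x : R => 1 + x) 1.
    have := is_deriveD (is_derive_cst (1 : R) x 1) (is_derive_id x 1).
    by rewrite add0r.
  have h2 := @is_derive1_comp R (fun y => y `^ (1 - p)) (+%R 1) x _ _ h hD.
  rewrite (_ : F = (1 - p)^-1 *: ((fun y => y `^ (1 - p)) \o +%R 1)) //.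
  apply: is_derive_eq; rewrite mulr1 /= [_ *: _]mulrA mulVf// mul1r.
  by congr (_ `^ _); rewrite addrAC subrr sub0r.
rewrite (@ge0_continuous_FTC2y R _ F _ 0).
- by rewrite -EFinB ltry.
- by move=> x x0; exact: powR_ge0.
- exact/continuous_subspaceT/continuous_weight.
- rewrite -[X in _ --> X](mulr0 (1 - p)^-1); apply: cvgMr.
  apply/cvgrPdist_le => e e0; near=> x.
  rewrite sub0r normrN ger0_norm ?powR_ge0//.
  have x1 : 0 <= 1 + x by rewrite addr_ge0//; near: x; exact: nbhs_pinfty_ge.
  (* Taking inverses turns the goal into e^-1 <= (1 + x)^(p - 1), true as soon as x >= (e^-1)^(1 /
     (p - 1)). *)
  rewrite -opprB powRN -[e]invrK lef_pV2 ?posrE ?invr_gt0 ?powR_gt0//; last first.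
    by rewrite ltr_pwDl//; near: x; exact: nbhs_pinfty_ge.
  have p0 : p - 1 != 0 by rewrite gt_eqF// subr_gt0.
  have -> : e^-1 = (e^-1 `^ (p - 1)^-1) `^ (p - 1).
    by rewrite -powRrM mulVf// powRr1// invr_ge0 ltW.
  apply: ge0_ler_powR; rewrite ?nnegrE ?powR_ge0 ?subr_ge0 ?(ltW p1)//.
  apply: (@le_trans _ _ x); last by rewrite lerDr.
  by near: x; exact: nbhs_pinfty_ge.
- by move=> x x0; have [] := dF x (lt_trans (ltrN10 _) x0).
- have [d0 _] := dF 0 (ltrN10 _).
  apply: cvg_at_right_filter.
  by apply: differentiable_continuous; apply/derivable1_diffP.
- move=> x; rewrite in_itv/= andbT => x0; rewrite derive1E.
  have [_ ->] := dF x (lt_trans (ltrN10 _) x0).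
  by rewrite ger0_norm// ltW.
Unshelve. all: by end_near.
Qed.

(** * Lebesgue and Borel measurability on the line *)

Lemma measurable_line_id (R : realType) :
  measurable_fun [set: line R] (idfun : line R -> measurableTypeR R).
Proof. by move=> _ B mB; rewrite setTI; exact: sub_caratheodory. Qed.

(** The identity from [line R] to the Borel line pushes the completed measure forward to a measure
    that agrees with Lebesgue measure on Borel sets; the rest is change of variables. *)
Lemma integral_completed_lebesgue (R : realType) (f : R -> \bar R) :
  measurable_fun [set: R] f -> (forall x, 0 <= f x)%E ->
  (\int[@completed_lebesgue_measure R]_x f x =
   \int[@lebesgue_measure R]_x f x)%E.
Proof.
move=> mf f0.
have mid := @measurable_line_id R.
have h := @ge0_integral_pushforward _ _ _ _ _ _ mid
  completed_lebesgue_measure setT f.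
rewrite preimage_setT in h.
etransitivity; first by apply: esym; apply: h.
by apply: eq_measure_integral.
Qed.

(** * Complex modulus and the complex integral *)

Lemma ReM (R : realType) (z t : R[i]) : complex.Re (z * t) =
  complex.Re z * complex.Re t - complex.Im z * complex.Im t.
Proof. by case: z t => ? ? []. Qed.

Lemma ImM (R : realType) (z t : R[i]) : complex.Im (z * t) =
  complex.Re z * complex.Im t + complex.Im z * complex.Re t.
Proof. by case: z t => ? ? []. Qed.

Lemma normcE (R : realType) (z : R[i]) :
  normc z = Num.sqrt (complex.Re z ^+ 2 + complex.Im z ^+ 2).
Proof. by case: z. Qed.

Lemma normc_Re (R : realType) (z : R[i]) : `|complex.Re z| <= normc z.
Proof.
by rewrite normcE -sqrtr_sqr ler_sqrt ?addr_ge0 ?sqr_ge0// lerDl sqr_ge0.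
Qed.

Lemma normc_Im (R : realType) (z : R[i]) : `|complex.Im z| <= normc z.
Proof.
by rewrite normcE -sqrtr_sqr ler_sqrt ?addr_ge0 ?sqr_ge0// lerDr sqr_ge0.
Qed.

Lemma normc_le_ReDIm (R : realType) (z : R[i]) :
  normc z <= `|complex.Re z| + `|complex.Im z|.
Proof.
rewrite normcE -[leRHS]ger0_norm ?addr_ge0// -[leRHS]sqrtr_sqr.
rewrite ler_sqrt ?sqr_ge0//.
by rewrite sqrrD !real_normK ?num_real// lerD2r lerDl mulrn_wge0// mulr_ge0.
Qed.

Lemma cmeasurableM d (T : measurableType d) (R : realType) (f g : T -> R[i]) :
  cmeasurable f -> cmeasurable g -> cmeasurable (fun x => f x * g x).
Proof.
move=> [f1 f2] [g1 g2]; split.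
- under eq_fun do rewrite ReM.
  by apply: measurable_funB; apply: measurable_funM.
- under eq_fun do rewrite ImM.
  by apply: measurable_funD; apply: measurable_funM.
Qed.

Lemma cmeasurable_comp d1 d2 (T1 : measurableType d1) (T2 : measurableType d2)
    (R : realType) (f : T2 -> R[i]) (g : T1 -> T2) :
  cmeasurable f -> measurable_fun [set: T1] g -> cmeasurable (fun x => f (g x)).
Proof.
move=> [f1 f2] mg.
by split; [exact: (measurableT_comp f1)|exact: (measurableT_comp f2)].
Qed.

Section cintegral.
Context d (T : measurableType d) (R : realType).
Variable mu : {measure set T -> \bar R}.
Implicit Types (f g : T -> R[i]).

(** The real and imaginary parts are dominated separately. This costs a factor 2, harmless for a
    boundedness statement. *)
Lemma cintegrable_le f (g : T -> R) : cmeasurable f ->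
  mu.-integrable [set: T] (EFin \o g) -> (forall x, normc (f x) <= g x) ->
  cintegrable mu f /\ normc (cintegral mu f) <= 2 * \int[mu]_x g x.
Proof.
move=> [mRe mIm] ig fg.
have nn x : g x <= `|g x| by exact: ler_norm.
have iRe : mu.-integrable [set: T] (fun x => (complex.Re (f x))%:E).
  apply: (le_integrable _ _ _ ig) => //; first exact/measurable_EFinP.
  by move=> x _; rewrite lee_fin (le_trans (normc_Re _))// (le_trans (fg x)).
have iIm : mu.-integrable [set: T] (fun x => (complex.Im (f x))%:E).
  apply: (le_integrable _ _ _ ig) => //; first exact/measurable_EFinP.
  by move=> x _; rewrite lee_fin (le_trans (normc_Im _))// (le_trans (fg x)).
split => //; apply: le_trans (normc_le_ReDIm _) _.
rewrite /= mulr2n mulrDl mul1r.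
by apply: lerD; (apply: le_trans (le_normr_Rintegral _ _) _ => //);
  apply: le_Rintegral => //; try exact: integrable_norm; move=> x _;
  rewrite (le_trans _ (fg x)) ?normc_Re ?normc_Im.
Qed.

(** Completeness of [mu] is what transfers measurability from [f] to [g]. This later allows the
    return from the modified kernel to the given one. *)
Lemma integrable_ae_eq (f g : T -> \bar R) : measure_is_complete mu ->
  f = g %[ae mu] -> mu.-integrable [set: T] f -> mu.-integrable [set: T] g.
Proof.
move=> cmu fg /integrableP[mf fy]; have mg := ae_measurable_fun cmu fg mf.
apply/integrableP; split => //.
rewrite (_ : (\int[mu]_x _ = \int[mu]_x `|f x|)%E)//.
apply: ae_eq_integral => //; [exact: measurableT_comp|exact: measurableT_comp|].
by apply: filterS fg => x fg _; rewrite fg.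
Qed.

Lemma cintegral_ae_eq f g : measure_is_complete mu ->
  f = g %[ae mu] -> cintegrable mu f ->
  cintegrable mu g /\ cintegral mu f = cintegral mu g.
Proof.
move=> cmu fg [iRe iIm].
have aeRe : (fun x => (complex.Re (f x))%:E) =
    (fun x => (complex.Re (g x))%:E) %[ae mu].
  by apply: filterS fg => x fg _; rewrite fg.
have aeIm : (fun x => (complex.Im (f x))%:E) =
    (fun x => (complex.Im (g x))%:E) %[ae mu].
  by apply: filterS fg => x fg _; rewrite fg.
have jRe := integrable_ae_eq cmu aeRe iRe.
have jIm := integrable_ae_eq cmu aeIm iIm.
split=> //; congr Complex; congr fine; apply: ae_eq_integral => //.
- exact: measurable_int iRe.
- exact: measurable_int jRe.
- exact: measurable_int iIm.
- exact: measurable_int jIm.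
Qed.

Lemma cintegralP (a : R[i]) f g : cintegrable mu f -> cintegrable mu g ->
  cintegral mu (fun x => a * f x + g x) = a * cintegral mu f + cintegral mu g.
Proof.
move=> [f1 f2] [g1 g2].
have iZ (b : R) (h : T -> R) : mu.-integrable setT (EFin \o h) ->
    mu.-integrable setT (EFin \o (fun x => b * h x)).
  move=> ih; have := integrableZl measurableT b ih.
  by apply: eq_integrable => // x _.
have iD (h1 h2 : T -> R) : mu.-integrable setT (EFin \o h1) ->
    mu.-integrable setT (EFin \o h2) ->
    mu.-integrable setT (EFin \o (fun x => h1 x + h2 x)).
  move=> i1 i2; have := integrableD measurableT i1 i2.
  by apply: eq_integrable => // x _.
have iB (h1 h2 : T -> R) : mu.-integrable setT (EFin \o h1) ->
    mu.-integrable setT (EFin \o h2) ->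
    mu.-integrable setT (EFin \o (fun x => h1 x - h2 x)).
  move=> i1 i2; have := integrableB measurableT i1 i2.
  by apply: eq_integrable => // x _.
have ReD (z t : R[i]) : complex.Re (z + t) = complex.Re z + complex.Re t.
  by case: z t => ? ? [].
have ImD (z t : R[i]) : complex.Im (z + t) = complex.Im z + complex.Im t.
  by case: z t => ? ? [].
apply/eqP; rewrite eq_complex ReD ImD ReM ImM/=.
apply/andP; split; apply/eqP.
- under [LHS]eq_Rintegral do rewrite ReD ReM.
  rewrite RintegralD//; last by apply: iB; exact: iZ.
  rewrite RintegralB//; [|exact: iZ|exact: iZ].
  by rewrite !RintegralZl.
- under [LHS]eq_Rintegral do rewrite ImD ImM.
  rewrite RintegralD//; last by apply: iD; exact: iZ.
  rewrite RintegralD//; [|exact: iZ|exact: iZ].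
  by rewrite !RintegralZl.
Qed.

End cintegral.

(** * Measurability of integrals depending on a parameter *)

(** Tonelli applies to the positive and negative parts separately. As [fine] is measurable, the
    sections at which the integral is infinite cause no trouble. *)
Lemma measurable_fun_Rintegral d1 d2 (T1 : measurableType d1)
    (T2 : measurableType d2) (R : realType)
    (m2 : {sigma_finite_measure set T2 -> \bar R}) (f : T1 * T2 -> R) :
  measurable_fun [set: T1 * T2] f ->
  measurable_fun [set: T1] (fun x => \int[m2]_y f (x, y)).
Proof.
move=> mf; have mE : measurable_fun [set: T1 * T2] (EFin \o f).
  exact/measurable_EFinP.
apply: (@measurableT_comp _ _ _ _ _ _ fine); first exact: fine_measurable.
under eq_fun do rewrite integralE.
apply: emeasurable_funB.
- rewrite (_ : (fun _ => _) = fubini_F m2 ((EFin \o f)^\+)%E).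
    apply: measurable_fun_fubini_tonelli_F; first exact: measurable_funepos.
    by move=> x; exact: funepos_ge0.
  by apply/funext => x; apply: eq_integral => y _; rewrite !funeposE.
- rewrite (_ : (fun _ => _) = fubini_F m2 ((EFin \o f)^\-)%E).
    apply: measurable_fun_fubini_tonelli_F; first exact: measurable_funeneg.
    by move=> x; exact: funeneg_ge0.
  by apply/funext => x; apply: eq_integral => y _; rewrite !funenegE.
Qed.

Lemma cmeasurable_cintegral d1 d2 (T1 : measurableType d1)
    (T2 : measurableType d2) (R : realType)
    (m2 : {sigma_finite_measure set T2 -> \bar R}) (f : T1 * T2 -> R[i]) :
  cmeasurable f -> cmeasurable (fun x => cintegral m2 (fun y => f (x, y))).
Proof.
move=> [f1 f2]; split.
- exact: (measurable_fun_Rintegral m2 f1).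
- exact: (measurable_fun_Rintegral m2 f2).
Qed.

(** * Replacement of the kernel by a Borel one *)

Notation leb R := (@completed_lebesgue_measure R).

Lemma ae_completed_lebesgue (R : realType) (P : set R) :
  {ae @lebesgue_measure R, forall x, P x} -> {ae leb R, forall x, P x}.
Proof.
by move=> [A [mA A0 PA]]; exists A; split => //; exact: sub_caratheodory.
Qed.

(** Tonelli asks for measurability in the product of the two line sigma-algebras, whereas [plane R]
    carries a larger one. Setting the kernel to 0 on a Borel null set [N] repairs this and preserves
    upper bounds on its modulus. *)
Lemma cmeasurable_kernel (R : realType) (K : R -> R -> R[i]) :
  lebesgue_measurable_kernel K ->
  exists k : line R -> line R -> R[i],
  [/\ cmeasurable (fun p : line R * line R => k p.1 p.2),
      forall x y, normc (k x y) <= normc (K x y) &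
      {ae leb R, forall x : line R, k x = K x %[ae leb R]}].
Proof.
move=> [/completed_measurable_fun[N1 [mN1 N10 K1]]
  /completed_measurable_fun[N2 [mN2 N20 K2]]].
pose N := N1 `|` N2.
have mN : measurable N by exact: measurableU.
have N0 : (@lebesgue_measure R \x @lebesgue_measure R)%E N = 0%E.
  by apply: measure_negligible => //; apply: negligibleU; exact/negligibleP.
pose P := (measurableTypeR R * measurableTypeR R)%type.
pose k (x y : line R) := if (x, y) \in (N : set P) then 0 else K x y.
have mid : measurable_fun [set: line R * line R]
    ((fun p => (p.1, p.2)) : line R * line R -> P).
  exact: (measurable_fun_pair
    (measurableT_comp (@measurable_line_id R) measurable_fst)
    (measurableT_comp (@measurable_line_id R) measurable_snd)).
(* Here [h] stands for the real or the imaginary part. Because h 0 = 0, composing [k] with [h] gives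
   the extension by zero of the function on the complement of [N]. *)
have mk (h : R[i] -> R) : h 0 = 0 ->
    measurable_fun (~` N) (fun p : P => h (K p.1 p.2)) ->
    measurable_fun [set: line R * line R] (fun p => h (k p.1 p.2)).
  move=> h0 /measurable_restrictT mh.
  have := measurableT_comp (mh (measurableC mN)) mid.
  congr measurable_fun; apply/funext => -[x y] /=; rewrite patchE /k in_setC.
  by case: ifPn; case: ifPn.
exists k; split.
- split; apply: mk => //.
  + apply: measurable_funS K1; first exact: measurableC.
    by move=> p Np N1p; apply: Np; left.
  + apply: measurable_funS K2; first exact: measurableC.
    by move=> p Np N2p; apply: Np; right.
- move=> x y; rewrite /k; case: ifP => // _; rewrite normc0; exact: normc_ge0.
- apply: ae_completed_lebesgue.
  have mx : measurable_fun [set: measurableTypeR R]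
      (fun x => lebesgue_measure (xsection N x)).
    exact: measurable_fun_xsection.
  (* The product measure of [N] is the integral of the measures of its sections, so almost every
     section is null. *)
  have /(ae_eq_integral_abs _ measurableT mx) :
      (\int[@lebesgue_measure R]_x `|lebesgue_measure (xsection N x)| = 0)%E.
    by rewrite -[RHS]N0; apply: eq_integral => x _; rewrite gee0_abs.
  apply: filterS => x /(_ I) Nx0.
  apply: ae_completed_lebesgue; exists (xsection N x); split => //.
    exact: measurable_xsection.
  move=> y /=; rewrite /k => h; rewrite /xsection/=.
  apply/negPn/negP => yN; apply: h => _.
  by rewrite (negbTE yN).
Qed.

(** * Estimates in the weighted norms *)

Section weight.
Context (R : realType).
Implicit Types (s p : R).

(** This is the L^2 norm of (1 + |x|)^(-p/2): [p] is the exponent after squaring. The value is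
    meaningful for p > 1, where the integral is finite. *)
Definition weightL2 p : R :=
  fine ((\int[leb R]_x ((1 + `|x : R|) `^ (- p))%:E) `^ 2^-1)%E.

Lemma measurable_weight p :
  measurable_fun [set: R] (fun x : R => (1 + `|x|) `^ p).
Proof. by apply: continuous_measurable_fun; exact: continuous_weight. Qed.

Lemma measurable_weight_line p :
  measurable_fun [set: line R] (fun x : line R => (1 + `|x : R|) `^ p).
Proof.
move=> _ Y mY; rewrite setTI; apply: sub_caratheodory.
by rewrite -[_ @^-1` _]setTI; exact: measurable_weight.
Qed.

Lemma weight_gt0 (x : R) : 0 < 1 + `|x|. Proof. by rewrite ltr_pwDl. Qed.

Lemma weightD (x p q : R) :
  (1 + `|x|) `^ (p + q) = (1 + `|x|) `^ p * (1 + `|x|) `^ q.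
Proof. by rewrite powRD// (gt_eqF (weight_gt0 x)) implybT. Qed.

Lemma weightL2E p : 1 < p ->
  (weightL2 p)%:E = ((\int[leb R]_x ((1 + `|x : R|) `^ (- p))%:E) `^ 2^-1)%E.
Proof.
move=> p1; rewrite fineK// ge0_fin_numE ?poweR_ge0//.
apply: poweR_lty; rewrite integral_completed_lebesgue.
- exact: integral_weight_lty.
- by apply/measurable_EFinP; exact: measurable_weight.
- by move=> x; rewrite lee_fin powR_ge0.
Qed.

Lemma weightL2_ge0 p : 0 <= weightL2 p.
Proof. by rewrite fine_ge0// poweR_ge0. Qed.

(** Writing -b = -(b + s) + s, the factor (1 + |y|)^(-(b + s)) is square integrable because 2(b + s)
    > 1, and the L^2 norm of the remaining factor is the norm of H^s. *)
Lemma cauchy_schwarz_hnorme s b (u : line R -> R[i]) :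
  cmeasurable u -> 1 < 2 * (b + s) ->
  (\int[leb R]_y ((1 + `|y : R|) `^ (- b) * normc (u y))%:E <=
   (weightL2 (2 * (b + s)))%:E * hnorme s u)%E.
Proof.
move=> mu bs.
pose f (y : line R) : R := (1 + `|y : R|) `^ (- (b + s)).
pose g (y : line R) : R := normc (u y) * (1 + `|y : R|) `^ s.
have mf : measurable_fun setT f by exact: measurable_weight_line.
have mg : measurable_fun setT g.
  by apply: measurable_funM; [exact: measurable_normc|
    exact: measurable_weight_line].
have two : (2^-1 + 2^-1 : R) = 1 by have := splitr (1 : R); rewrite !mul1r.
have := @hoelder _ _ _ (leb R) f g 2 2 mf mg ltac:(by []) ltac:(by []) two.
rewrite Lnorm1 (weightL2E bs) => h.
apply: le_trans (le_trans h _).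
  rewrite le_eqVlt; apply/orP; left; apply/eqP; apply: eq_integral => y _ /=.
  congr EFin; rewrite /f /g [RHS]ger0_norm; last first.
    by rewrite mulr_ge0 ?powR_ge0// mulr_ge0 ?normc_ge0 ?powR_ge0.
  by rewrite mulrCA mulrC -weightD opprD addrNK.
have -> : 'N[leb R]_2%:E[EFin \o f]%E =
    ((\int[leb R]_x ((1 + `|x : R|) `^ (- (2 * (b + s))))%:E) `^ 2^-1)%E.
  rewrite unlock /Lnorm/=; congr (_ `^ _)%E.
  apply: eq_integral => y _; congr EFin.
  by rewrite ger0_norm ?powR_ge0// -powRrM mulNr mulrC.
have -> // : 'N[leb R]_2%:E[EFin \o g]%E = hnorme s u.
rewrite unlock /Lnorm/=; congr (_ `^ _)%E.
apply: eq_integral => y _; congr EFin.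
rewrite ger0_norm ?mulr_ge0 ?normc_ge0 ?powR_ge0//.
rewrite powRM ?normc_ge0 ?powR_ge0// powR_mulrn ?normc_ge0//.
by rewrite -powRrM [s * 2]mulrC.
Qed.

(** The squared norm of the majorant is C^2 times the integral of (1 + |x|)^(-2(a - s)), which
    converges by the condition on [a]. *)
Lemma hnorme_le s a (C : R) (v : line R -> R[i]) : cmeasurable v -> 0 <= C ->
  1 < 2 * (a - s) -> (forall x, normc (v x) <= C * (1 + `|x : R|) `^ (- a)) ->
  (hnorme s v <= (C * weightL2 (2 * (a - s)))%:E)%E.
Proof.
move=> mv C0 as1 vC; rewrite EFinM weightL2E//.
(* As the square root of C^2, the constant can be moved under the power 1/2 and then into the
   integral. *)
have -> : (C%:E = (C ^+ 2)%:E `^ 2^-1)%E.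
  by rewrite poweR_EFin -powR_mulrn// -powRrM divff ?powRr1.
rewrite -poweRM; last 2 first.
- by rewrite lee_fin sqr_ge0.
- by apply: integral_ge0 => x _; rewrite lee_fin powR_ge0.
have mw : measurable_fun [set: line R]
    (fun x => ((1 + `|x : R|) `^ (- (2 * (a - s))))%:E).
  apply/measurable_EFinP; exact: measurable_weight_line.
rewrite -ge0_integralZl//; last by rewrite lee_fin sqr_ge0.
rewrite /hnorme /wnorme; apply: gt0_ler_poweR.
- by rewrite invr_ge0.
- rewrite in_itv/= leey andbT; apply: integral_ge0 => x _.
  by rewrite lee_fin mulr_ge0 ?sqr_ge0// powR_ge0.
- rewrite in_itv/= leey andbT; apply: integral_ge0 => x _.
  by rewrite -EFinM lee_fin mulr_ge0 ?sqr_ge0// powR_ge0.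
apply: ge0_le_integral.
- exact: measurableT.
- by move=> x _; rewrite lee_fin mulr_ge0 ?sqr_ge0// powR_ge0.
- apply/measurable_EFinP; apply: measurable_funM; last exact: measurable_hweight.
  exact/measurable_funX/measurable_normc.
- exact: measurable_funeM.
move=> x _; rewrite -EFinM lee_fin /hweight.
have -> : (1 + `|x : R|) `^ (- (2 * (a - s))) =
    ((1 + `|x : R|) `^ (- a)) ^+ 2 * (1 + `|x : R|) `^ (2 * s).
  rewrite -powR_mulrn ?powR_ge0// -powRrM -weightD.
  by congr (_ `^ _); rewrite mulrBr opprB addrC mulNr [a * _]mulrC.
rewrite mulrA -exprMn ler_wpM2r ?powR_ge0// ler_pXn2r ?nnegrE ?normc_ge0//.
by rewrite mulr_ge0 ?powR_ge0.
Qed.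

End weight.

(** The base 1 + |x| + |y| dominates both 1 + |x| and 1 + |y|, and powers with exponents -a, -b <= 0
    reverse the order. *)
Lemma weight_add_le (R : realType) (a b x y : R) : 0 <= a -> 0 <= b ->
  (1 + `|x| + `|y|) `^ (- (a + b)) <= (1 + `|x|) `^ (- a) * (1 + `|y|) `^ (- b).
Proof.
move=> a0 b0; have xy0 : 0 < 1 + `|x| + `|y| by rewrite ltr_wpDr ?weight_gt0.
rewrite opprD powRD; last by rewrite (gt_eqF xy0) implybT.
apply: ler_pM; rewrite ?powR_ge0// !powRN lef_pV2 ?posrE ?powR_gt0 ?weight_gt0//.
- apply: ge0_ler_powR => //;
    by rewrite ?nnegrE ?(ltW xy0) ?(ltW (weight_gt0 _))// lerDl.
- apply: ge0_ler_powR => //;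
    by rewrite ?nnegrE ?(ltW xy0) ?(ltW (weight_gt0 _))// addrAC lerDl.
Qed.

(** * The integral operator on functions and on classes *)

Lemma pi_linear (R : realType) (s : R) (z : R[i]) (u v : hfun s) :
  z *: \pi_(Hspace s)%qT u + \pi_(Hspace s)%qT v =
  \pi_(Hspace s)%qT (z *: u + v) :> Hspace s.
Proof.
by rewrite -[LHS]/(H_scale z _ + _) (H_scaleE z u) -pi_addr.
Qed.

Definition integral_op (R : realType) (k : line R -> line R -> R[i])
    (u : line R -> R[i]) (x : line R) : R[i] :=
  cintegral (leb R) (fun y => k x y * u y).

Section integral_op.
Context (R : realType) (s1 s2 a b c : R) (k : line R -> line R -> R[i]).
Hypothesis mk : cmeasurable (fun p : line R * line R => k p.1 p.2).
Hypothesis c0 : 0 <= c.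
Hypothesis kE : forall x y : line R,
  normc (k x y) <= c * ((1 + `|x : R|) `^ (- a) * (1 + `|y : R|) `^ (- b)).
Hypothesis b1 : 1 < 2 * (b + s1).
Hypothesis a1 : 1 < 2 * (a - s2).
Implicit Type u : hfun s1.

Let op_bound : R := 2 * c * weightL2 (2 * (b + s1)).

(** The bound on [k] holds at every point and the Cauchy-Schwarz estimate in [y] does not involve
    [x], so convergence and the bound hold for every [x]. *)
Lemma normc_integral_op_le u x :
  cintegrable (leb R) (fun y => k x y * u y) /\
  normc (integral_op k u x) <=
    op_bound * fine (hnorme s1 u) * (1 + `|x : R|) `^ (- a).
Proof.
have mu := hfun_measurable u.
pose g (y : line R) : R := (1 + `|y : R|) `^ (- b) * normc (u y).
have mg : measurable_fun [set: line R] g.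
  by apply: measurable_funM; [exact: measurable_weight_line|
    exact: measurable_normc].
have g0 y : 0 <= g y by rewrite mulr_ge0 ?powR_ge0 ?normc_ge0.
have gle := cauchy_schwarz_hnorme mu b1.
have gE : (\int[leb R]_y (g y)%:E <=
    (weightL2 (2 * (b + s1)) * fine (hnorme s1 u))%:E)%E.
  by rewrite EFinM (fineK (H_norm_fin u)).
have ig : (leb R).-integrable [set: line R] (EFin \o g).
  apply/integrableP; split; first exact/measurable_EFinP.
  under eq_integral do rewrite /= ger0_norm ?g0//.
  by apply: le_lt_trans gE _; rewrite ltry.
(* [C] collects the part of the kernel bound that is constant in [y], so the integrand is dominated
   by [C * g y]. *)
pose C := c * (1 + `|x : R|) `^ (- a).
have iCg : (leb R).-integrable [set: line R] (EFin \o (fun y => C * g y)).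
  by have := integrableZl measurableT C ig; apply: eq_integrable => // y _.
have [|y|i1 i2] := @cintegrable_le _ _ _ (leb R) (fun y => k x y * u y)
  (fun y => C * g y) _ iCg.
- apply: cmeasurableM mu; exact: (cmeasurable_comp mk (pair1_measurable x)).
- rewrite normcM /C /g mulrA -[c * _ * _]mulrA ler_wpM2r ?normc_ge0//.
split => //; apply: le_trans i2 _; rewrite RintegralZl//.
rewrite (_ : op_bound * _ * _ =
  2 * (C * (weightL2 (2 * (b + s1)) * fine (hnorme s1 u)))); last first.
  by rewrite /op_bound /C; ring.
rewrite ler_pM2l// ler_wpM2l ?mulr_ge0 ?powR_ge0//.
by rewrite -lee_fin fineK// (integrable_fin_num measurableT ig).
Qed.

Lemma cmeasurable_integral_op u : cmeasurable (integral_op k u).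
Proof.
apply: (@cmeasurable_cintegral _ _ _ _ _ (leb R)
  (fun p : line R * line R => k p.1 p.2 * u p.2)).
apply: cmeasurableM => //.
exact: (cmeasurable_comp (hfun_measurable u) measurable_snd).
Qed.

Lemma hnorme_integral_op u :
  (hnorme s2 (integral_op k u) <=
   (op_bound * fine (hnorme s1 u) * weightL2 (2 * (a - s2)))%:E)%E.
Proof.
apply: hnorme_le.
- exact: cmeasurable_integral_op.
- by rewrite !mulr_ge0 ?weightL2_ge0 ?fine_ge0 ?wnorme_ge0.
- exact: a1.
- by move=> x; have [] := normc_integral_op_le u x.
Qed.

Lemma integral_op_hfun u : integral_op k u \in hfun_pred s2.
Proof.
rewrite inE /=; split; first exact: cmeasurable_integral_op.
by apply: le_lt_trans (hnorme_integral_op u) _; rewrite ltry.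
Qed.

(** Since every integral converges, changing [u] on a null set alters none of them: the images
    coincide at every point. *)
Lemma integral_op_ae_eq (u v : hfun s1) :
  (u : line R -> R[i]) = v %[ae leb R] ->
  integral_op k u = integral_op k v.
Proof.
move=> uv; apply/funext => x.
have [iu _] := normc_integral_op_le u x.
apply: (cintegral_ae_eq completed_lebesgue_measure_is_complete _ iu).2.
by apply: filterS uv => y uv _; rewrite uv.
Qed.

Definition Hop (U : Hspace s1) : Hspace s2 :=
  \pi_(Hspace s2)%qT (HFun (integral_op_hfun (repr U))).

(** The choice made by [repr] in [Hop] is immaterial, since representatives of one class have the
    same image. *)
Lemma Hop_pi u : Hop (\pi_(Hspace s1)%qT u) =
  \pi_(Hspace s2)%qT (HFun (integral_op_hfun u)).
Proof.
apply/H_eqP; apply: aeW => x _ /=; congr (_ x); apply: integral_op_ae_eq.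
by apply/H_eqP; rewrite reprK.
Qed.

Lemma Hop_linear : linear Hop.
Proof.
move=> z; elim/quotW => u; elim/quotW => v.
(* Both sides are rewritten as classes of explicit functions, which are then compared pointwise by
   linearity of convergent integrals. *)
apply: etrans (congr1 Hop (pi_linear z u v)) _.
apply: etrans (Hop_pi (z *: u + v)) _.
apply: etrans _ (congr2 (fun A B => z *: A + B)
  (esym (Hop_pi u)) (esym (Hop_pi v))).
apply: etrans _ (esym (pi_linear z (HFun (integral_op_hfun u))
  (HFun (integral_op_hfun v)))).
apply/H_eqP; apply: aeW => x _ /=.
have [iu _] := normc_integral_op_le u x.
have [iv _] := normc_integral_op_le v x.
rewrite -[RHS]/(z * integral_op k u x + integral_op k v x) -cintegralP//.
congr cintegral; apply/funext => y.
by rewrite -[LHS]/(k x y * (z * hfun_val u y + hfun_val v y)) mulrDr mulrCA.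
Qed.

Lemma Hop_bounded U : `|Hop U| <= op_bound * weightL2 (2 * (a - s2)) * `|U|.
Proof.
elim/quotW: U => u.
rewrite Hop_pi -[`|_|]/(H_norm _) -[X in _ <= _ * X]/(H_norm _) !H_norm_pi.
rewrite mulrAC -lee_fin fineK ?hnorme_integral_op//.
by have := H_norm_fin (HFun (integral_op_hfun u)).
Qed.

End integral_op.

(** * Choice of the exponents and conclusion *)

Unset Implicit Arguments.
Set Strict Implicit.

Theorem theorem1 (R : realType) (kappa s1 s2 : R) (K : R -> R -> R[i])
    (K_meas : lebesgue_measurable_kernel K)
    (K_sim : kernel_sim kappa K)
    (s1_lt0 : s1 < 0)
    (kappa_gt : Num.max (1 / 2 - s1) (1 + s2 - s1) < kappa) :
  exists T : {linear Hspace s1 -> Hspace s2},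
    is_integral_operator K T /\
    exists C : R, forall u : Hspace s1, `|T u| <= C * `|u|.
Proof.
have [c1 [c [_ c_gt0 Kc]]] := K_sim.
have [k [mk kK kae]] := cmeasurable_kernel K_meas.
set m := Num.max _ _ in kappa_gt.
have m1 : 1 / 2 - s1 <= m by rewrite le_max lexx.
have m2 : 1 + s2 - s1 <= m by rewrite le_max lexx orbT.
(* Half of the gap kappa - m goes to each exponent: b + s1 = 1/2 + d, while a = m - (1/2 - s1) + d
   is at least [d] by [m1] and a - s2 is at least 1/2 + d by [m2]. Finally b >= 0 because s1 < 0. *)
pose d := (kappa - m) / 2; pose b := 1 / 2 - s1 + d; pose a := kappa - b.
have ab : kappa = a + b by rewrite subrK.
have d0 : 0 < d by rewrite divr_gt0// subr_gt0.
have dE : kappa = m + d + d by rewrite -addrA -splitr subrKC.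
have kE x y : normc (k x y) <=
    c * ((1 + `|x : R|) `^ (- a) * (1 + `|y : R|) `^ (- b)).
  apply: le_trans (kK x y) _; have /andP[_] := Kc x y.
  move=> /le_trans; apply; rewrite ler_pM2l// ab; apply: weight_add_le.
    by rewrite /a /b; lra.
  by rewrite /b; lra.
have b1 : 1 < 2 * (b + s1) by rewrite /b; lra.
have a1 : 1 < 2 * (a - s2) by rewrite /a /b; lra.
pose T0 := Hop mk (ltW c_gt0) kE b1 a1.
pose T : {linear Hspace s1 -> Hspace s2} :=
  HB.pack T0 (GRing.isLinear.Build _ _ _ _ T0
    (Hop_linear mk (ltW c_gt0) kE b1 a1)).
exists T; split; last first.
  by eexists => U; exact: Hop_bounded.
move=> u; have /H_eqP : \pi_(Hspace s2)%qT (repr (T (\pi_(Hspace s1)%qT u))) =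
    \pi_(Hspace s2)%qT (HFun (integral_op_hfun mk (ltW c_gt0) kE b1 a1 u)).
  by rewrite reprK; exact: Hop_pi.
(* For almost every [x], the chosen representative takes the value of the integral with kernel [k],
   and [k x] equals [K x] almost everywhere. Completeness of the measure then carries integrability
   and value over to [K]. *)
move=> Tu; apply: filterS2 Tu kae => x /(_ I) -> kx.
have [iu _] := normc_integral_op_le mk (ltW c_gt0) kE b1 u x.
apply: (cintegral_ae_eq completed_lebesgue_measure_is_complete _ iu).
by apply: filterS kx => y kx _; rewrite kx.
Qed.
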